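(* Let $M$ be an oriented space-like hypersurface in the Minkowski space $\mathbb{E}^{n+1}_1$ with position vector $x$ such that $x^T\neq0$ on $M$, and suppose that $\langle x,x\rangle>0$ on $M$ (resp. $\langle x,x\rangle<0$ on $M$). Put $\mu=\sqrt{|\langle x,x\rangle|}$, $e_1=x^T/\langle x^T,x^T\rangle^{1/2}$, and let the angle function $\theta$ be defined by $$x=\mu\cosh\theta\, e_1-\mu\sinh\theta\, N\qquad\big(\text{resp. } x=\mu\sinh\theta\, e_1-\mu\cosh\theta\, N\big),$$ where $N$ is the unit normal vector field of $M$. Then $M$ is a GCR hypersurface if and only if $Y(\theta)=0$ for every tangent vector field $Y$ of $M$ with $\langle Y,x^T\rangle=0$.
   Context: $\mathbb{E}^{n+1}_1$ is $\mathbb{R}^{n+1}$ with the metric $\langle\ ,\ \rangle=-dx_1^2+\sum_{j=2}^{n+1}dx_j^2$. A hypersurface is space-like if its induced metric is Riemannian; its unit normal $N$ then satisfies $\langle N,N\rangle=-1$ (when $\langle x,x\rangle<0$, $N$ is oriented so that $\langle x,N\rangle>0$, as required by the displayed decomposition). The shape operator $S$ is given by $\widetilde\nabla_XN=-S(X)$, with $\widetilde\nabla$ the flat connection of $\mathbb{E}^{n+1}_1$; principal directions are eigenvectors of $S$. The position vector decomposes as $x=x^T+x^\perp$ into tangential and normal parts along $M$. $M$ is a generalized constant ratio (GCR) hypersurface if $x^T$ is a principal direction of $M$. *)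

(* Defs.v *)
From mathcomp Require Export all_boot all_order all_algebra.
From mathcomp Require Export all_classical all_reals all_analysis.
Export numFieldNormedType.Exports.
Export Order.TTheory GRing.Theory Num.Theory.

Set Implicit Arguments.
Unset Strict Implicit.
Unset Printing Implicit Defensive.

Local Open Scope classical_set_scope.
Local Open Scope ring_scope.

Section Smooth.
Context {R : realType} {V W : normedModType R}.

Fixpoint Ck_on (k : nat) (U : set V) (f : V -> W) : Prop :=
  if k is k'.+1 then
    (forall a, U a -> differentiable f a) /\
    (forall v, Ck_on k' U (fun a => 'D_v f a))
  else forall a, U a -> {for a, continuous f}.

(* C^oo on U, meant for an open U. *)
Definition smooth_on (U : set V) (f : V -> W) : Prop := forall k, Ck_on k U f.

End Smooth.

(* The chart i is the homeomorphism [chart i] from the open set [dom i] onto the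
   open set [cod i] of R^n, with inverse [param i]; both are total functions
   whose values outside of [dom i], resp. [cod i], are irrelevant.
   [chart_at p] is a chosen chart around p, used to represent tangent vectors. *)
Record smooth_manifold (R : realType) (n : nat) := SmoothManifold {
  carrier :> topologicalType;
  manifold_hausdorff : hausdorff_space carrier;
  manifold_second_countable : @second_countable carrier;
  chart_index : Type;
  dom : chart_index -> set carrier;
  cod : chart_index -> set 'rV[R]_n;
  chart : chart_index -> carrier -> 'rV[R]_n;
  param : chart_index -> 'rV[R]_n -> carrier;
  chart_at : carrier -> chart_index;
  mem_chart_at : forall p, dom (chart_at p) p;
  open_dom : forall i, open (dom i);
  open_cod : forall i, open (cod i);
  chart_cod : forall i p, dom i p -> cod i (chart i p);
  param_dom : forall i u, cod i u -> dom i (param i u);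
  chartK : forall i p, dom i p -> param i (chart i p) = p;
  paramK : forall i u, cod i u -> chart i (param i u) = u;
  chart_continuous : forall i p, dom i p -> {for p, continuous (chart i)};
  param_continuous : forall i u, cod i u -> {for u, continuous (param i)};
  transition_smooth : forall i j,
    smooth_on (chart i @` (dom i `&` dom j)) (chart j \o param i)
}.

Section Manifold.
Context {R : realType} {n : nat} {M : smooth_manifold R n}.

Definition msmooth_on {W : normedModType R} (A : set M) (f : M -> W) : Prop :=
  forall i, smooth_on (chart i @` (dom i `&` A)) (f \o param i).

Definition msmooth {W : normedModType R} (f : M -> W) : Prop :=
  msmooth_on setT f.

(* A tangent vector at p is represented by its components v : 'rV[R]_n in the
   chart [chart_at p]; [mdiff f p v] is then the derivative v(f) = df_p(v). *)
Definition mdiff {W : normedModType R} (f : M -> W) (p : M) (v : 'rV[R]_n) : W :=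
  'D_v (f \o param (chart_at p)) (chart (chart_at p) p).

(* The components of Y in the chart i are the derivatives along Y of the
   coordinate functions of that chart. *)
Definition smooth_vector_field (Y : M -> 'rV[R]_n) : Prop :=
  forall i, msmooth_on (dom i) (fun p => mdiff (chart i) p (Y p)).

End Manifold.

Definition mink {R : realType} {n : nat} (u w : 'rV[R]_n.+1) : R :=
  - (u 0 0 * w 0 0) + \sum_(j < n) u 0 (lift ord0 j) * w 0 (lift ord0 j).

Definition cosh {R : realType} (t : R) : R := (expR t + expR (- t)) / 2.
Definition sinh {R : realType} (t : R) : R := (expR t - expR (- t)) / 2.

Section Hypersurface.
Context {R : realType} {n : nat} {M : smooth_manifold R n}.
Implicit Types (x N : M -> 'rV[R]_n.+1) (p : M) (v w : 'rV[R]_n).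

Definition induced_metric x p v w : R := mink (mdiff x p v) (mdiff x p w).

(* A space-like hypersurface with position vector x, oriented by the unit normal
   field N.  Positive definiteness of the induced metric forces each
   differential of x to be injective, so x is an immersion. *)
Record spacelike_hypersurface x N : Prop := SpacelikeHypersurface {
  position_smooth : msmooth x;
  induced_metric_gt0 : forall p v, v != 0 -> 0 < induced_metric x p v v;
  normal_smooth : msmooth N;
  normal_orthogonal : forall p v, mink (N p) (mdiff x p v) = 0;
  normal_unit : forall p, mink (N p) (N p) = -1
}.

(* The tangent vector x^T at p, i.e. the unique v such that x - dx(v) is
   orthogonal to the tangent space; as a vector of Minkowski space, x^T is
   [mdiff x p (tangential_part x p)]. *)
Definition tangential_part x p : 'rV[R]_n :=
  xget 0 [set v | forall w, mink (x p - mdiff x p v) (mdiff x p w) = 0].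

(* The shape operator, S(v) = - (derivative of N along v), with values in the
   image of the differential of x. *)
Definition shape N p v : 'rV[R]_n.+1 := - mdiff N p v.

Definition principal_direction x N p v : Prop :=
  v != 0 /\ exists k : R, shape N p v = k *: mdiff x p v.

Definition GCR x N : Prop :=
  forall p, principal_direction x N p (tangential_part x p).

Definition mu x p : R := Num.sqrt `|mink (x p) (x p)|.

(* e_1 = x^T / <x^T,x^T>^(1/2), as a vector of Minkowski space *)
Definition e1 x p : 'rV[R]_n.+1 :=
  let xT := tangential_part x p in
  (Num.sqrt (induced_metric x p xT xT))^-1 *: mdiff x p xT.

End Hypersurface.

(* Main.v *)
Require Import Defs.
From mathcomp Require Import ring.
Local Open Scope classical_set_scope.
Local Open Scope ring_scope.

(** Write [r = <x, N>], [q = <x, x>] and [T = x + r N] for the tangential part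
of [x], so that [<T, T> = q + r^2].  In both causal cases
[mu e^theta = sqrt (q + r^2) + r], whence
[theta = ln (sqrt (q + r^2) + r) - ln mu].  If [Y] is orthogonal to [T] then
[Y q = 0] and [Y r = <dN Y, T> = <dN T, Y>] by symmetry of the second
fundamental form, so [Y theta = <dN T, Y> / sqrt (q + r^2)].  Therefore
[Y theta = 0] for all [Y] orthogonal to [T] iff [dN T] is proportional to [T].
The converse direction needs every tangent vector [w] orthogonal to [T] at a
point to be, up to a nonzero factor, the value of a global smooth field
orthogonal to [T]: instead of cutting off with bump functions, project the
ambient field [(q + r^2) a - <a, T> x], with [a = dx w] constant, onto the
tangent spaces. *)

Set Implicit Arguments.
Unset Strict Implicit.
Unset Printing Implicit Defensive.

(** * Derivatives along lines and symmetry of mixed second derivatives *)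

Section SecondDerivative.
Context {R : realType} {V : normedModType R}.
Implicit Types (f : V -> R) (a v w : V).

Lemma is_derive_lineP f a v (s df : R) :
  is_derive s 1 (fun t : R => f (a + t *: v)) df <-> is_derive (a + s *: v) v f df.
Proof.
set g := fun t : R => f (a + t *: v).
have E : (fun h : R => h^-1 *: ((g \o shift s) (h *: 1) - g s)) =
  (fun h : R => h^-1 *: ((f \o shift (a + s *: v)) (h *: v) - f (a + s *: v))).
  apply/funext => h /=; congr (_ *: (f _ - _)).
  by rewrite [h *: 1]mulr1 scalerDl addrCA.
have dE : derivable g s 1 = derivable f (a + s *: v) v.
  by rewrite /derivable E.
have DE : 'D_1 g s = 'D_v f (a + s *: v) by rewrite /derive E.
by split=> -[d D]; constructor; [rewrite -dE|rewrite -DE|rewrite dE|rewrite DE].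
Qed.

(** Restricting [f] to the line through [a] leaves a composition of two functions of one real
    variable, so derivability of [f] along [v] alone suffices. *)
Lemma is_derive_comp1 (phi : R -> R) f a v (dphi df : R) :
  is_derive (f a) 1 phi dphi -> is_derive a v f df ->
  is_derive a v (phi \o f) (dphi * df).
Proof.
rewrite -{1 2 3}[a](addr0 a) -(scale0r v) => dp /is_derive_lineP df'.
apply/is_derive_lineP.
exact: (@is_derive1_comp _ phi (fun t : R => f (a + t *: v))).
Qed.

Lemma MVT_line f a v (h : R) : 0 < h ->
  (forall s, 0 <= s <= h -> derivable f (a + s *: v) v) ->
  exists2 c, 0 <= c <= h & f (a + h *: v) - f a = h * 'D_v f (a + c *: v).
Proof.
move=> h0 df.
have [||c ch] := @MVT R (fun t => f (a + t *: v))
  (fun t => 'D_v f (a + t *: v)) 0 h h0.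
- move=> s; rewrite in_itv/= => /andP[s0 sh]; apply/is_derive_lineP/derivableP.
  by apply: df; rewrite !ltW.
- apply: derivable_within_continuous => s; rewrite in_itv/= => sh.
  by have [] := (is_derive_lineP f a v s _).2 (derivableP (df s sh)).
rewrite scale0r addr0 subr0 => ->; exists c; last by rewrite mulrC.
by move: ch; rewrite in_itv/= => /andP[? ?]; rewrite !ltW.
Qed.

(* The left-hand side is symmetric in v and w, which is what makes the mixed
   derivatives agree. *)
Lemma second_difference f a v w (h : R) : 0 < h ->
  (forall s t, 0 <= s <= h -> 0 <= t <= h ->
    derivable f (a + s *: v + t *: w) v /\
    derivable ('D_v f) (a + s *: v + t *: w) w) ->
  exists s t, [/\ 0 <= s <= h, 0 <= t <= h &
    f (a + h *: v + h *: w) - f (a + h *: v) - (f (a + h *: w) - f a) =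
    h * (h * 'D_w ('D_v f) (a + s *: v + t *: w))].
Proof.
move=> h0 df.
have h00 : 0 <= (0 : R) <= h by rewrite lexx ltW.
have hh : 0 <= h <= h by rewrite lexx ltW.
(* The second difference is the increment of [g] along [v]. The mean value theorem is applied to [g]
   along [v], then to ['D_v f] along [w]. *)
pose g : V -> R := (fun b => f (b + h *: w)) - f.
have dg s : 0 <= s <= h -> is_derive (a + s *: v) v g
   ('D_v f (a + s *: v + h *: w) - 'D_v f (a + s *: v)).
  move=> sh; apply: is_deriveB.
    have [d _] := df _ _ sh hh.
    have E : (fun t : R => t^-1 *: (((fun b => f (b + h *: w)) \o
          shift (a + s *: v)) (t *: v) - f (a + s *: v + h *: w))) =
      (fun t : R => t^-1 *: ((f \o shift (a + s *: v + h *: w)) (t *: v) -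
          f (a + s *: v + h *: w))).
      by apply/funext => t /=; rewrite !addrA.
    by split; rewrite /derivable /derive E.
  by have [d _] := df _ _ sh h00; rewrite scale0r addr0 in d; exact: derivableP.
have [s sh /= e1] := @MVT_line g a v h h0 (fun s sh => @ex_derive _ _ _ _ _ _ _ (dg s sh)).
have [t th e2] := @MVT_line ('D_v f) (a + s *: v) w h h0 (fun t th => (df s t sh th).2).
exists s, t; split => //; rewrite -e2.
have := @derive_val _ _ _ _ _ _ _ (dg s sh) => <-; rewrite -e1.
by rewrite /g !fctE; ring.
Qed.

Lemma nbhs_parallelogram a v w (P : set V) : nbhs a P ->
  exists2 h : R, 0 < h & forall s t, 0 <= s <= h -> 0 <= t <= h ->
    P (a + s *: v + t *: w).
Proof.
move=> /nbhs_normP[e /= e0 eP].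
(* The displacement has norm at most [h * K]; the summand 1 keeps [K] positive when [v] and [w] both
   vanish, and halving [e / K] makes the final bound strict. *)
pose K := `|v| + `|w| + 1.
have K0 : 0 < K by rewrite ltr_wpDl ?addr_ge0.
exists (e / K / 2); first by rewrite !divr_gt0.
move=> s t /andP[s0 sh] /andP[t0 th]; apply: eP; rewrite /ball_/=.
rewrite -!addrA opprD addrA subrr sub0r normrN (le_lt_trans (ler_normD _ _))//.
rewrite !normrZ !ger0_norm//.
have H : (e / K / 2) * K < e.
  rewrite -mulrA [_^-1 * K]mulrC mulrA divfK ?gt_eqF//.
  by rewrite ltr_pdivrMr// ltr_pMr// ltr1n.
apply: le_lt_trans H; rewrite /K !mulrDr mulr1 -[leLHS]addr0 !lerD ?ler_wpM2r//.
by rewrite !divr_ge0// ltW.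
Qed.

(** On a small parallelogram at [a], each mixed derivative takes somewhere the value of the second
    difference divided by [h * h]. Continuity at [a] then puts the two values at [a] within every
    [e > 0] of each other. *)
Lemma schwarz f a v w :
  (\forall b \near a, [/\ derivable f b v, derivable f b w,
     derivable ('D_v f) b w & derivable ('D_w f) b v]) ->
  {for a, continuous ('D_w ('D_v f))} -> {for a, continuous ('D_v ('D_w f))} ->
  'D_w ('D_v f) a = 'D_v ('D_w f) a.
Proof.
move=> df cwv cvw.
apply/eqP; rewrite -subr_eq0 -normr_le0; apply/ler_addgt0Pl => e e0; rewrite addr0.
have e20 : 0 < e / 2 by rewrite divr_gt0.
have /cvgrPdist_lt/(_ _ e20) near1 := cwv.
have /cvgrPdist_lt/(_ _ e20) near2 := cvw.
have [h h0 H] := nbhs_parallelogram v w (filterI df (filterI near1 near2)).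
have [s [t [sh th E1]]] := @second_difference f a v w h h0 (fun s t sh th =>
  let: conj (And4 d1 _ d3 _) _ := H s t sh th in conj d1 d3).
(* The same data with the roles of [v] and [w] exchanged. *)
have H' s' t' : 0 <= s' <= h -> 0 <= t' <= h ->
  derivable f (a + s' *: w + t' *: v) w /\
  derivable ('D_w f) (a + s' *: w + t' *: v) v.
  by move=> sh' th'; rewrite [a + s' *: w + _]addrAC; have [[]] := H _ _ th' sh'.
have [s' [t' [sh' th' E2]]] := second_difference h0 H'.
have [_ [K1 _]] := H _ _ sh th.
have [_ [_ K2]] := H _ _ th' sh'.
have E : 'D_w ('D_v f) (a + s *: v + t *: w) = 'D_v ('D_w f) (a + s' *: w + t' *: v).
  apply: (mulfI (lt0r_neq0 h0)); apply: (mulfI (lt0r_neq0 h0)).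
  rewrite -[LHS]E1 -[RHS]E2 [a + h *: w + h *: v]addrAC.
  move: (f (a + _ + _)) (f (a + h *: v)) (f (a + h *: w)) (f a) => A1 A2 A3 A4.
  by ring.
rewrite [a + t' *: v + s' *: w]addrAC -E in K2.
rewrite (splitr e) -(subrKA ('D_w ('D_v f) (a + s *: v + t *: w))).
apply: le_trans (ler_normD _ _) _; apply: lerD; last by rewrite distrC; exact: ltW K2.
exact: ltW K1.
Qed.

End SecondDerivative.

(** The first-order expansion of [f] at [a], with the same differential, is also an expansion of
    [g]. *)
Lemma near_eq_differentiable (R : numFieldType) (V W : normedModType R)
    (f g : V -> W) (a : V) :
  (\near a, f a = g a) -> differentiable f a -> differentiable g a.
Proof.
move=> fg /diff_locallyP[cdf fE].
have gE : g \o shift a = cst (g a) + 'd f a +o_ (0 : V) id.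
  apply/eqaddoP => e e0; move/eqaddoP: fE => /(_ e e0).
  have : \forall h \near (0 : V), f (h + a) = g (h + a).
    by move: fg; rewrite (near_shift 0 a)/= subr0.
  apply: filterS2 => h fgh; rewrite !fctE /= -(nbhs_singleton fg).
  by rewrite fgh.
by apply/diff_locallyP; rewrite (diff_unique cdf gE).
Qed.

(** * Closure properties of the class C^k on an open set *)

Section CkVector.
Context {R : realType} {V W : normedModType R} (U : set V).
Implicit Types f g : V -> W.

Lemma CkS k f : Ck_on k.+1 U f -> Ck_on k U f.
Proof.
elim: k f => [|k IH] f; first by move=> [df _] a /df/differentiable_continuous.
by move=> [df Df]; split=> // v; exact/IH/Df.
Qed.

Context (oU : open U).

(** Since [U] is open, agreement on [U] is agreement near each of its points, hence passes to all
    directional derivatives. *)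
Lemma Ck_eq k f g : {in U, f =1 g} -> Ck_on k U f -> Ck_on k U g.
Proof.
have nearU a (h1 h2 : V -> W) : U a -> {in U, h1 =1 h2} -> \near a, h1 a = h2 a.
  move=> Ua e; have : nbhs a U by exact: open_nbhs_nbhs.
  by apply: filterS => b Ub; apply: e; rewrite inE.
elim: k f g => [|k IH] f g fg /=.
  move=> cf a Ua; rewrite /prop_for /continuous_at -(nbhs_singleton (nearU _ _ _ Ua fg)).
  by apply: cvg_trans (cf a Ua); apply: near_eq_cvg; exact: nearU.
move=> [df Df]; split.
  by move=> a Ua; apply: near_eq_differentiable (df a Ua); exact: nearU.
move=> v; apply: IH (Df v) => a; rewrite inE => Ua.
by apply: near_eq_derive; exact: nearU.
Qed.

Lemma Ck_cst k (c : W) : Ck_on k U (fun=> c).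
Proof.
elim: k c => [|k IH] c /=; first by move=> a _; exact: cst_continuous.
split=> [a _|v]; first exact: differentiable_cst.
rewrite (_ : 'D_v _ = (fun=> 0)); first exact: IH.
by apply/funext => a; exact: derive_cst.
Qed.

Lemma CkD k f g : Ck_on k U f -> Ck_on k U g -> Ck_on k U (fun a => f a + g a).
Proof.
elim: k f g => [|k IH] f g /=.
  by move=> cf cg a Ua; apply: continuousD; [exact: cf|exact: cg].
move=> [df Df] [dg Dg]; split=> [a Ua|v].
  by apply: differentiableD; [exact: df|exact: dg].
apply: (@Ck_eq _ (fun a => 'D_v f a + 'D_v g a)); last exact: IH.
move=> a; rewrite inE => Ua; rewrite (@deriveD _ _ _ f g)//; apply: diff_derivable.
  exact: df.
exact: dg.
Qed.

Lemma Ck_sum k (I : Type) (r : seq I) (P : pred I) (F : I -> V -> W) :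
  (forall i, P i -> Ck_on k U (F i)) -> Ck_on k U (fun a => \sum_(i <- r | P i) F i a).
Proof.
move=> CF; elim: r => [|i r IH].
  by apply: (@Ck_eq _ (fun=> 0)); [move=> a _; rewrite big_nil|exact: Ck_cst].
have [Pi|nPi] := boolP (P i).
  apply: (@Ck_eq _ (fun a => F i a + \sum_(i <- r | P i) F i a)).
    by move=> a _; rewrite big_cons Pi.
  by apply: CkD IH; exact: CF.
by apply: Ck_eq IH => a _; rewrite big_cons (negbTE nPi).
Qed.

End CkVector.

Section CkScalar.
Context {R : realType} {V : normedModType R} (U : set V).
Context (oU : open U).
Implicit Types f g : V -> R.

Lemma CkM k f g : Ck_on k U f -> Ck_on k U g -> Ck_on k U (fun a => f a * g a).
Proof.
elim: k f g => [|k IH] f g /=.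
  by move=> cf cg a Ua; apply: continuousM; [exact: cf|exact: cg].
move=> [df Df] [dg Dg]; split=> [a Ua|v].
  by apply: differentiableM; [exact: df|exact: dg].
apply: (@Ck_eq _ _ _ _ oU _ (fun a => f a * 'D_v g a + g a * 'D_v f a)).
  move=> a; rewrite inE => Ua; rewrite (@deriveM _ _ f g)//; apply: diff_derivable.
    exact: df.
  exact: dg.
(* The product rule involves [f] and [g] themselves, which [CkS] brings down from order [k.+1] to
   [k]. *)
apply: CkD => //; apply: IH => //; apply: CkS; split=> //.
Qed.

Lemma CkV k f : (forall a, U a -> f a != 0) -> Ck_on k U f ->
  Ck_on k U (fun a => (f a)^-1).
Proof.
move=> f0; elim: k => [|k IH] /=.
  by move=> cf a Ua; apply: continuousV; [exact: f0|exact: cf].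
move=> [df Df]; split=> [a Ua|v].
  by apply: differentiableV; [exact: df|exact: f0].
(* With the square split into two inverses, the induction hypothesis on the inverse and [CkM]
   suffice. *)
apply: (@Ck_eq _ _ _ _ oU _ (fun a => -1 * ((f a)^-1 * (f a)^-1 * 'D_v f a))).
  move=> a; rewrite inE => Ua; rewrite deriveV ?f0//; last exact/diff_derivable/df.
  by rewrite mulN1r scaleNr /= expr2 invfM.
have /IH cV : Ck_on k U f by apply: CkS; split.
by do ?apply: CkM => //; exact: Ck_cst.
Qed.

Lemma Ck_prod k (I : Type) (r : seq I) (P : pred I) (F : I -> V -> R) :
  (forall i, P i -> Ck_on k U (F i)) -> Ck_on k U (fun a => \prod_(i <- r | P i) F i a).
Proof.
move=> CF; elim: r => [|i r IH].
  by apply: (@Ck_eq _ _ _ _ oU _ (fun=> 1 : R)); [move=> a _; rewrite big_nil|exact: Ck_cst].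
have [Pi|nPi] := boolP (P i).
  apply: (@Ck_eq _ _ _ _ oU _ (fun a => F i a * \prod_(i <- r | P i) F i a)).
    by move=> a _; rewrite big_cons Pi.
  by apply: CkM IH; exact: CF.
by apply: (Ck_eq oU) IH => a _; rewrite big_cons (negbTE nPi).
Qed.

End CkScalar.

(** * Matrix-valued functions of class C^k *)

Section CkMatrix.
Context {R : realType} {V : normedModType R} (U : set V).
Context (oU : open U).

Lemma differentiable_mxP m n (F : V -> 'M[R]_(m, n)) a :
  differentiable F a <-> forall i j, differentiable (fun b => F b i j) a.
Proof.
split=> [dF i j|dF].
  exact: (@differentiable_comp _ _ _ _ F _ _ dF (differentiable_coord _ i j)).
have -> : F = \sum_(i < m) \sum_(j < n) (fun b => F b i j *: delta_mx i j).
  apply/funext => b; rewrite [LHS]matrix_sum_delta fct_sumE.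
  by apply: eq_bigr => i _; rewrite fct_sumE.
apply: differentiable_sum => i; apply: differentiable_sum => j.
exact: differentiableZl.
Qed.

Lemma Ck_mxP k m n (F : V -> 'M[R]_(m, n)) :
  Ck_on k U F <-> forall i j, Ck_on k U (fun a => F a i j).
Proof.
elim: k F => [|k IH] F /=.
  split=> [cF i j a Ua|cF a Ua].
    apply: (@continuous_comp _ _ _ F (fun M : 'M[R]_(m, n) => M i j)); first exact: cF.
    exact: coord_continuous.
  apply/cvgrPdist_le => e e0; near=> b.
  (* The matrix norm is the maximum over finitely many entries, so the entrywise neighbourhoods can
     be intersected. *)
  rewrite /Num.Def.normr/= mx_normrE (bigmax_le _ (ltW e0))//= => i _.
  rewrite !mxE; move: i; near: b; apply: filter_forall => /= i.
  exact: (cvgrPdist_le _ _).1 (cF i.1 i.2 a Ua) e e0.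
have DE v : (forall a, U a -> differentiable F a) -> forall i j,
    {in U, (fun a => 'D_v F a i j) =1 'D_v (fun a => F a i j)}.
  move=> dF i j a; rewrite inE => Ua.
  by rewrite derive_mx ?mxE//; exact/diff_derivable/dF.
split=> [[dF DF] i j|CF].
  split=> [a /dF/differentiable_mxP//|v].
  by apply: (Ck_eq oU) ((IH _).1 (DF v) i j); exact: DE.
have dF a : U a -> differentiable F a.
  by move=> Ua; apply/differentiable_mxP => i j; exact: (CF i j).1.
split=> // v; apply/IH => i j.
apply: (Ck_eq oU) ((CF i j).2 v) => a Ua; apply/esym; exact: DE.
Unshelve. all: by end_near. Qed.

Lemma Ck_scale k m n (f : V -> R) (F : V -> 'M[R]_(m, n)) :
  Ck_on k U f -> Ck_on k U F -> Ck_on k U (fun a => f a *: F a).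
Proof.
move=> Cf /Ck_mxP CF; apply/Ck_mxP => i j.
apply: (@Ck_eq _ _ _ _ oU _ (fun a => f a * F a i j)).
  by move=> a _; rewrite mxE.
exact: CkM.
Qed.

Lemma Ck_det k n (F : V -> 'M[R]_n) :
  (forall i j, Ck_on k U (fun a => F a i j)) -> Ck_on k U (fun a => \det (F a)).
Proof.
move=> CF; apply: Ck_sum => // s _; apply: CkM => //; first exact: Ck_cst.
by apply: Ck_prod => // i _; exact: CF.
Qed.

Lemma Ck_mulmx k m n p (F : V -> 'M[R]_(m, n)) (G : V -> 'M[R]_(n, p)) :
  Ck_on k U F -> Ck_on k U G -> Ck_on k U (fun a => F a *m G a).
Proof.
move=> /Ck_mxP CF /Ck_mxP CG; apply/Ck_mxP => i j.
apply: (@Ck_eq _ _ _ _ oU _ (fun a => \sum_l F a i l * G a l j)).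
  by move=> a _; rewrite mxE.
by apply: Ck_sum => // l _; apply: CkM.
Qed.

(** By Cramer's rule the entries of the inverse are cofactors, polynomial in the entries of [F],
    over a determinant that does not vanish. *)
Lemma Ck_invmx k n (F : V -> 'M[R]_n) : (forall a, U a -> F a \in unitmx) ->
  Ck_on k U F -> Ck_on k U (fun a => invmx (F a)).
Proof.
move=> uF /Ck_mxP CF; apply/Ck_mxP => i j.
apply: (@Ck_eq _ _ _ _ oU _ (fun a => (\det (F a))^-1 *
    ((-1) ^+ (j + i) * \det (row' j (col' i (F a)))))).
  by move=> a; rewrite inE => Ua; rewrite /invmx uF// !mxE.
apply: CkM => //.
  apply: CkV => //; last exact: Ck_det.
  by move=> a Ua; rewrite -unitfE -unitmxE uF.
apply: CkM => //; first exact: Ck_cst.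
apply: Ck_det => k1 k2.
by apply: (Ck_eq oU) (CF (lift j k1) (lift i k2)) => a _; rewrite !mxE.
Qed.

End CkMatrix.

(** * Mixed and partial derivatives of matrix-valued maps *)

Section MatrixValuedDerivative.
Context {R : realType} {V : normedModType R}.

Lemma schwarz_mx m n (U : set V) (F : V -> 'M[R]_(m, n)) a v w :
  open U -> Ck_on 2 U F -> U a -> 'D_w ('D_v F) a = 'D_v ('D_w F) a.
Proof.
move=> oU C2 Ua.
have dF b : U b -> differentiable F b by case: C2 => + _; apply.
have dDF z b : U b -> differentiable ('D_z F) b.
  by case: C2 => _ /(_ z)[+ _]; apply.
have nU : nbhs a U by exact: open_nbhs_nbhs.
have DE z b i j : U b -> 'D_z F b i j = 'D_z (fun a => F a i j) b.
  by move=> Ub; rewrite derive_mx ?mxE//; exact/diff_derivable/dF.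
have DDE y z i j : 'D_y ('D_z F) a i j = 'D_y ('D_z (fun a => F a i j)) a.
  rewrite derive_mx ?mxE; last exact/diff_derivable/dDF.
  by apply: near_eq_derive; apply: filterS nU => b; exact: DE.
apply/matrixP => i j.
transitivity ('D_w ('D_v (fun a => F a i j)) a); first exact: DDE.
transitivity ('D_v ('D_w (fun a => F a i j)) a); last exact/esym/DDE.
have [_ Cij] := (Ck_mxP oU 2 F).1 C2 i j.
apply: schwarz.
- apply: filterS nU => b Ub.
  have [d1 _] := (Ck_mxP oU 2 F).1 C2 i j.
  by split; apply: diff_derivable; [exact: d1|exact: d1|exact: (Cij _).1|exact: (Cij _).1].
- exact: ((Cij v).2 w).
- exact: ((Cij w).2 v).
Qed.

Lemma derive_sum_delta n (W : normedModType R) (F : 'rV[R]_n -> W) u v :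
  differentiable F u -> 'D_v F u = \sum_(k < n) v 0 k *: 'D_(delta_mx 0 k) F u.
Proof.
move=> dF; rewrite deriveE// [in LHS](row_sum_delta v) linear_sum/=.
by apply: eq_bigr => k _; rewrite linearZ/= deriveE.
Qed.

End MatrixValuedDerivative.

(** * Algebra and calculus of the Minkowski product *)

Section Minkowski.
Context {R : realType} {n : nat}.
Implicit Types u v w : 'rV[R]_n.+1.

(** The signature, which turns [mink] into one weighted sum and so treats all coordinates
    uniformly. *)
Let sg (j : 'I_n.+1) : R := if j == 0 then -1 else 1.

Lemma mink_sum u w : mink u w = \sum_j sg j * (u 0 j * w 0 j).
Proof.
rewrite big_ord_recl /sg eqxx mulN1r /mink; congr (_ + _).
by apply: eq_bigr => j _; rewrite mul1r.
Qed.

Lemma minkC u w : mink u w = mink w u.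
Proof. by rewrite !mink_sum; apply: eq_bigr => j _; rewrite [u _ _ * _]mulrC. Qed.

Lemma minkDl u v w : mink (u + v) w = mink u w + mink v w.
Proof.
by rewrite !mink_sum -big_split; apply: eq_bigr => j _ /=; rewrite !mxE; ring.
Qed.

Lemma minkZl (a : R) u w : mink (a *: u) w = a * mink u w.
Proof.
by rewrite !mink_sum mulr_sumr; apply: eq_bigr => j _ /=; rewrite !mxE; ring.
Qed.

Lemma minkNl u w : mink (- u) w = - mink u w.
Proof. by rewrite -scaleN1r minkZl mulN1r. Qed.

Lemma minkBl u v w : mink (u - v) w = mink u w - mink v w.
Proof. by rewrite minkDl minkNl. Qed.

Lemma mink0l w : mink 0 w = 0.
Proof. by rewrite -(scale0r w) minkZl mul0r. Qed.

Lemma minkDr u v w : mink w (u + v) = mink w u + mink w v.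
Proof. by rewrite minkC minkDl ![mink w _]minkC. Qed.

Lemma minkZr (a : R) u w : mink w (a *: u) = a * mink w u.
Proof. by rewrite minkC minkZl minkC. Qed.

Lemma minkBr u v w : mink w (u - v) = mink w u - mink w v.
Proof. by rewrite minkC minkBl ![mink w _]minkC. Qed.

Lemma mink_suml (I : finType) (F : I -> 'rV[R]_n.+1) w :
  mink (\sum_i F i) w = \sum_i mink (F i) w.
Proof.
apply: (big_morph (fun u => mink u w)) => [u v|]; first exact: minkDl.
exact: mink0l.
Qed.

Lemma mink_nondegenerate u : (forall w, mink u w = 0) -> u = 0.
Proof.
move=> u0; apply/rowP => j; have := u0 (delta_mx 0 j).
rewrite mink_sum (bigD1 j)//= big1 ?addr0; last first.
  by move=> k /negbTE kj; rewrite !mxE kj andbF !mulr0.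
rewrite !mxE !eqxx mulr1 => /eqP; rewrite mulf_eq0 /sg.
by case: ifP => _; rewrite ?oppr_eq0 oner_eq0/= => /eqP.
Qed.

Context {V : normedModType R}.
Implicit Types f g : V -> 'rV[R]_n.+1.

Lemma is_derive_mink f g (a v : V) : derivable f a v -> derivable g a v ->
  is_derive a v (fun b => mink (f b) (g b))
    (mink ('D_v f a) (g a) + mink (f a) ('D_v g a)).
Proof.
move=> df dg.
have dfj j := (derivable_mxP _ _ _).1 df 0 j.
have dgj j := (derivable_mxP _ _ _).1 dg 0 j.
pose h j : V -> R := sg j *: ((fun b => f b 0 j) * (fun b => g b 0 j)).
have -> : (fun b => mink (f b) (g b)) = \sum_j h j.
  by apply/funext => b; rewrite mink_sum fct_sumE.
apply: is_derive_eq.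
  apply: is_derive_sum => j; apply: is_deriveZ; apply: is_deriveM.
    exact: derivableP (dfj j).
  exact: derivableP (dgj j).
rewrite !mink_sum -big_split; apply: eq_bigr => j _ /=.
rewrite (derive_mx df) (derive_mx dg) !mxE -mulrDr; congr (_ * _).
by rewrite addrC [X in X + _]mulrC.
Qed.

Lemma Ck_mink k (U : set V) f g : open U -> Ck_on k U f -> Ck_on k U g ->
  Ck_on k U (fun b => mink (f b) (g b)).
Proof.
move=> oU /(Ck_mxP oU) Cf /(Ck_mxP oU) Cg.
apply: (@Ck_eq _ _ _ _ oU _ (fun b => \sum_j sg j * (f b 0 j * g b 0 j))).
  by move=> b _; rewrite mink_sum.
apply: Ck_sum => // j _; apply: CkM => //; first exact: Ck_cst.
exact: CkM.
Qed.

End Minkowski.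

(** * Change of chart for derivatives on the manifold *)

Section Charts.
Context {R : realType} {n : nat} {M : smooth_manifold R n}.
Implicit Types (i j : chart_index M) (p : M) (v w : 'rV[R]_n).

(** The image is the part of [cod i] that [param i] maps into [A], and [param i] is continuous on
    the open set [cod i]. *)
Lemma open_chart_image i (A : set M) : open A -> open (chart i @` (dom i `&` A)).
Proof.
move=> oA; have -> : chart i @` (dom i `&` A) = [set u | cod i u /\ A (param i u)].
  apply/seteqP; split=> [_ [p [ip Ap] <-]|u [iu Au]] /=.
    by rewrite chartK//; split=> //; exact: chart_cod.
  by exists (param i u); [split=> //; exact: param_dom|exact: paramK].
rewrite openE => u [iu Au] /=; apply: filterI.
  by apply: open_nbhs_nbhs; split=> //; exact: open_cod.
by apply: (param_continuous iu); apply: open_nbhs_nbhs.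
Qed.

Lemma overlap_nbhs i j p : dom i p -> dom j p ->
  nbhs (chart i p) (chart i @` (dom i `&` dom j)).
Proof.
move=> ip jp; apply: open_nbhs_nbhs; split.
  exact/open_chart_image/open_dom.
by exists p.
Qed.

Lemma differentiable_transition i j p : dom i p -> dom j p ->
  differentiable (chart j \o param i) (chart i p).
Proof.
by move=> ip jp; have [+ _] := @transition_smooth _ _ M i j 1; apply; exists p.
Qed.

(** The chain rule for [f \o param j] after the transition map; this composite agrees with
    [f \o param i] only on the overlap, which is a neighbourhood of the point. *)
Lemma derive_chart_change (W : normedModType R) (f : M -> W) i j p v :
  dom i p -> dom j p -> differentiable (f \o param j) (chart j p) ->
  'D_v (f \o param i) (chart i p) =
  'D_('D_v (chart j \o param i) (chart i p)) (f \o param j) (chart j p).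
Proof.
move=> ip jp df; have dt := differentiable_transition ip jp.
have tE : (chart j \o param i) (chart i p) = chart j p by rewrite /= chartK.
have df' : differentiable (f \o param j) ((chart j \o param i) (chart i p)).
  by rewrite tE.
have -> : 'D_v (f \o param i) (chart i p) =
    'D_v ((f \o param j) \o (chart j \o param i)) (chart i p).
  apply: near_eq_derive; apply: filterS (overlap_nbhs ip jp).
  by move=> _ [q [iq jq] <-] /=; rewrite !chartK.
rewrite (deriveE v (differentiable_comp dt df')) (deriveE v dt) (deriveE _ df).
transitivity ('d (f \o param j) ((chart j \o param i) (chart i p))
    ('d (chart j \o param i) (chart i p) v)).
  exact: (congr1 (fun L => L v) (diff_comp dt df')).
by rewrite tE.
Qed.

Lemma derive_chartK i p v : dom i p -> 'D_v (chart i \o param i) (chart i p) = v.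
Proof.
move=> ip; rewrite -[RHS](derive_id (chart i p) v).
apply: near_eq_derive; apply: filterS (overlap_nbhs ip ip).
by move=> _ [q [iq _] <-] /=; rewrite chartK.
Qed.

(** The change of chart formula for the function [chart i] itself: the differentials of the two
    transition maps are mutually inverse. *)
Lemma derive_transitionK i j p v : dom i p -> dom j p ->
  'D_('D_v (chart j \o param i) (chart i p)) (chart i \o param j) (chart j p) = v.
Proof.
move=> ip jp; rewrite -(derive_chart_change v ip jp) ?derive_chartK//.
exact: differentiable_transition.
Qed.

Lemma msmooth_differentiable (W : normedModType R) (f : M -> W) i p :
  msmooth f -> dom i p -> differentiable (f \o param i) (chart i p).
Proof. by move=> sf ip; have [+ _] := sf i 1; apply; exists p. Qed.

Lemma mdiff_chart (W : normedModType R) (f : M -> W) i p v :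
  dom i p -> differentiable (f \o param i) (chart i p) ->
  mdiff f p v = 'D_(mdiff (chart i) p v) (f \o param i) (chart i p).
Proof. by move=> ip df; exact: (derive_chart_change v (mem_chart_at p) ip df). Qed.

End Charts.

(** * Orthogonal projection of ambient vectors onto the tangent spaces *)

Section Projection.
Context {R : realType} {n : nat} {M : smooth_manifold R n}
  (x N : M -> 'rV[R]_n.+1) (hM : spacelike_hypersurface x N).
Implicit Types (i j : chart_index M) (p : M) (u v w : 'rV[R]_n) (z : 'rV[R]_n.+1).

Local Notation X i := (x \o param i).
Local Notation e k := (delta_mx 0 k : 'rV[R]_n).

Lemma differentiable_position i p : dom i p -> differentiable (X i) (chart i p).
Proof. by apply: msmooth_differentiable; exact: position_smooth hM. Qed.

Lemma derive_mdiff i p v : dom i p ->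
  'D_v (X i) (chart i p) = mdiff x p ('D_v (chart (chart_at p) \o param i) (chart i p)).
Proof.
by move=> ip; apply: (derive_chart_change v ip (mem_chart_at p));
  exact/differentiable_position/mem_chart_at.
Qed.

(** Positivity is assumed in the chart [chart_at p] only; it carries over because the differential
    of a transition map is injective. *)
Lemma chart_metric_gt0 i p v : dom i p -> v != 0 ->
  0 < mink ('D_v (X i) (chart i p)) ('D_v (X i) (chart i p)).
Proof.
move=> ip v0; rewrite derive_mdiff//; apply: (induced_metric_gt0 hM).
apply: contra_neq v0 => v'0.
by rewrite -(derive_transitionK v ip (mem_chart_at p)) v'0 derive0.
Qed.

Lemma derive_position_sum i p v : dom i p ->
  'D_v (X i) (chart i p) = \sum_k v 0 k *: 'D_(e k) (X i) (chart i p).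
Proof. by move=> ip; exact/derive_sum_delta/differentiable_position. Qed.

Lemma mink_derive_sum i p v z : dom i p ->
  mink ('D_v (X i) (chart i p)) z =
  \sum_k v 0 k * mink ('D_(e k) (X i) (chart i p)) z.
Proof.
move=> ip; rewrite derive_position_sum// mink_suml.
by apply: eq_bigr => k _; rewrite minkZl.
Qed.

Definition gram i u : 'M[R]_n :=
  \matrix_(k, l) mink ('D_(e k) (X i) u) ('D_(e l) (X i) u).

(* In the chart i, the components of the tangential projection of z. *)
Definition coords i z u : 'rV[R]_n :=
  (\row_l mink z ('D_(e l) (X i) u)) *m invmx (gram i u).

Lemma mul_gram i p v l : dom i p ->
  (v *m gram i (chart i p)) 0 l =
  mink ('D_v (X i) (chart i p)) ('D_(e l) (X i) (chart i p)).
Proof.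
by move=> ip; rewrite mink_derive_sum// mxE; apply: eq_bigr => k _; rewrite mxE.
Qed.

(** A vector in the kernel would have length zero, against positive definiteness. *)
Lemma gram_unit i p : dom i p -> gram i (chart i p) \in unitmx.
Proof.
move=> ip; rewrite -row_free_unit; apply: inj_row_free => v vG.
apply/eqP; apply: contraT => /(chart_metric_gt0 ip).
rewrite mink_derive_sum// big1 ?ltxx// => k _.
by rewrite minkC -mul_gram// vG mxE mulr0.
Qed.

Lemma coordsP i p z w : dom i p ->
  mink ('D_(coords i z (chart i p)) (X i) (chart i p)) ('D_w (X i) (chart i p)) =
  mink z ('D_w (X i) (chart i p)).
Proof.
move=> ip; rewrite minkC [RHS]minkC !mink_derive_sum//.
apply: eq_bigr => k _; congr (_ * _); rewrite minkC [RHS]minkC -mul_gram//.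
by rewrite /coords -mulmxA mulVmx ?gram_unit// mulmx1 mxE.
Qed.

Lemma mdiff_linear (W : normedModType R) (f : M -> W) p (a : R) v w :
  differentiable (f \o param (chart_at p)) (chart (chart_at p) p) ->
  mdiff f p (a *: v + w) = a *: mdiff f p v + mdiff f p w.
Proof. by move=> df; rewrite /mdiff !(deriveE _ df) linearP. Qed.

(** The difference of the two candidates is orthogonal to every tangent vector, in particular to
    itself. *)
Lemma coords_unique i p v z : dom i p ->
  (forall w, mink ('D_v (X i) (chart i p)) ('D_w (X i) (chart i p)) =
     mink z ('D_w (X i) (chart i p))) -> v = coords i z (chart i p).
Proof.
move=> ip vz; have dX := differentiable_position ip.
apply/eqP; rewrite -subr_eq0; apply: contraT => /(chart_metric_gt0 ip).
rewrite {1}(deriveE _ dX) linearB/= -!(deriveE _ dX) minkBl vz.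
by rewrite coordsP// subrr ltxx.
Qed.

Definition tproj z p : 'rV[R]_n := coords (chart_at p) z (chart (chart_at p) p).

Lemma tprojP z p w : mink (mdiff x p (tproj z p)) (mdiff x p w) = mink z (mdiff x p w).
Proof. exact/coordsP/mem_chart_at. Qed.

Lemma tproj_unique p v z :
  (forall w, mink (mdiff x p v) (mdiff x p w) = mink z (mdiff x p w)) -> v = tproj z p.
Proof. exact/coords_unique/mem_chart_at. Qed.

Lemma mdiff_chart_tproj j p z : dom j p ->
  mdiff (chart j) p (tproj z p) = coords j z (chart j p).
Proof.
move=> jp; apply: coords_unique => // w.
rewrite -mdiff_chart//; last exact: differentiable_position.
by rewrite derive_mdiff// tprojP.
Qed.

(** The chart [chart_at p] may jump with [p], so the components are rewritten through a fixed chart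
    [j]: there they are [coords j] times the Jacobian matrix of a transition map, both smooth. *)
Lemma smooth_tproj (Z : M -> 'rV[R]_n.+1) : msmooth Z ->
  smooth_vector_field (fun p => tproj (Z p) p).
Proof.
move=> sZ i j k; set U := chart j @` _.
have oU : open U by exact/open_chart_image/open_dom.
pose tau := chart i \o param j.
pose J u : 'M[R]_n := \matrix_(l, m) ('D_(e l) tau u) 0 m.
apply: (@Ck_eq _ _ _ U oU k (fun u => coords j (Z (param j u)) u *m J u)).
  move=> u; rewrite inE => -[p [jp ip] <-] /=; rewrite chartK//.
  rewrite (mdiff_chart _ jp); last exact: differentiable_transition.
  rewrite mdiff_chart_tproj// (derive_sum_delta _ (differentiable_transition jp ip)).
  apply/rowP => m; rewrite mxE summxE; apply: eq_bigr => l _.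
  by rewrite !mxE.
have subU : U `<=` chart j @` (dom j `&` setT).
  by move=> _ [p [jp _] <-]; exists p.
have sub_smooth (W : normedModType R) (f : M -> W) m : msmooth f -> Ck_on m U (f \o param j).
  move=> sf; have := sf j m; move: (f \o param j) => g.
  elim: m g => [|m IH] g /= => [cg a /subU /cg//|[dg Dg]].
  by split=> [a /subU /dg//|v]; exact: IH.
(* Order [k.+1] of [x] is used, since one order is spent on the derivative. *)
have CX l : Ck_on k U ('D_(e l) (X j)) := (sub_smooth _ _ k.+1 (position_smooth hM)).2 _.
have CZ : Ck_on k U (Z \o param j) := sub_smooth _ _ _ sZ.
apply: Ck_mulmx => //; last first.
  apply/Ck_mxP => // l m.
  apply: (@Ck_eq _ _ _ _ oU _ (fun u => 'D_(e l) tau u 0 m)).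
    by move=> u _; rewrite mxE.
  exact: ((Ck_mxP oU k _).1 ((transition_smooth j i k.+1).2 (e l)) 0 m).
apply: Ck_mulmx => //.
  apply/Ck_mxP => // l m.
  apply: (@Ck_eq _ _ _ _ oU _ (fun u => mink (Z (param j u)) ('D_(e m) (X j) u))).
    by move=> u _; rewrite mxE.
  exact: Ck_mink.
apply: Ck_invmx => //; first by move=> _ [p [jp _] <-]; exact: gram_unit.
apply/Ck_mxP => // l m.
apply: (@Ck_eq _ _ _ _ oU _ (fun u => mink ('D_(e l) (X j) u) ('D_(e m) (X j) u))).
  by move=> u _; rewrite mxE.
exact: Ck_mink.
Qed.

(** The tangent space and [N p] span the ambient space: in a vanishing combination, pairing with
    [N p] kills the normal coefficient and positive definiteness the tangential part; then ranks are
    counted. Nondegeneracy of [mink] concludes. *)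
Lemma normal_complement p z : (forall w, mink z (mdiff x p w) = 0) ->
  mink z (N p) = 0 -> z = 0.
Proof.
move=> zT zN; apply: mink_nondegenerate => w.
pose J : 'M[R]_(n, n.+1) := \matrix_(k, l) (mdiff x p (e k)) 0 l.
have JE v : v *m J = mdiff x p v.
  rewrite [RHS](derive_position_sum v (mem_chart_at p)).
  apply/rowP => m; rewrite mxE summxE; apply: eq_bigr => k _.
  by rewrite !mxE.
have AE (v : 'rV[R]_(n + 1)) : v *m col_mx J (N p) =
    mdiff x p (lsubmx v) + (rsubmx v) 0 0 *: N p.
  rewrite -{1}(hsubmxK v) mul_row_col JE; congr (_ + _).
  by rewrite [Y in Y *m _]mx11_scalar mul_scalar_mx.
have A_free : row_free (col_mx J (N p)).
  apply: inj_row_free => v; rewrite AE => v0.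
  have r0 : (rsubmx v) 0 0 = 0.
    have := congr1 (mink (N p)) v0.
    rewrite minkDr minkZr (normal_orthogonal hM) (normal_unit hM) add0r.
    by rewrite [RHS]minkC mink0l mulrN1 => /eqP; rewrite oppr_eq0 => /eqP.
  have l0 : lsubmx v = 0.
    apply/eqP; apply: contraT => /(induced_metric_gt0 hM p).
    move: v0; rewrite r0 scale0r addr0 /induced_metric => ->.
    by rewrite mink0l ltxx.
  rewrite -(hsubmxK v) l0 [rsubmx v]mx11_scalar r0 raddf0.
  exact: row_mx0.
have A_full : row_full (col_mx J (N p)).
  by rewrite /row_full (eqP A_free) addn1.
have /submxP[c ->] := submx_full w A_full.
by rewrite AE minkDr minkZr zT zN mulr0 addr0.
Qed.

End Projection.

(** * The second fundamental form and the derivative of the angle *)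

Section AngleFunction.
Context {R : realType} {n : nat} {M : smooth_manifold R n}
  (x N : M -> 'rV[R]_n.+1) (hM : spacelike_hypersurface x N).
Implicit Types (p : M) (v w : 'rV[R]_n).

Lemma is_derive_mink_param (f g : M -> 'rV[R]_n.+1) p v : msmooth f -> msmooth g ->
  is_derive (chart (chart_at p) p) v
    ((fun q => mink (f q) (g q)) \o param (chart_at p))
    (mink (mdiff f p v) (g p) + mink (f p) (mdiff g p v)).
Proof.
move=> sf sg; have cp := mem_chart_at p.
have df := diff_derivable (v := v) (msmooth_differentiable sf cp).
have dg := diff_derivable (v := v) (msmooth_differentiable sg cp).
by apply: is_derive_eq (is_derive_mink df dg) _; rewrite /= chartK.
Qed.

Lemma mink_normal_mdiff p v : mink (mdiff N p v) (N p) = 0.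
Proof.
have sN := normal_smooth hM.
have := @derive_val _ _ _ _ _ _ _ (is_derive_mink_param p v sN sN).
rewrite (_ : _ \o _ = cst (-1)); last first.
  by apply/funext => u /=; rewrite (normal_unit hM).
rewrite derive_cst [X in _ + X]minkC => /esym/eqP.
by rewrite -mulr2n mulrn_eq0/= => /eqP.
Qed.

(** Differentiate along [v] the identity [mink N (dx w) = 0], where [w] is extended with constant
    components in the chart. *)
Lemma second_form_hessian p v w :
  mink (mdiff N p v) (mdiff x p w) = - mink (N p)
    ('D_v ('D_w (x \o param (chart_at p))) (chart (chart_at p) p)).
Proof.
have cp := mem_chart_at p; set c := chart_at p; set u := chart c p.
have dN := diff_derivable (v := v) (msmooth_differentiable (normal_smooth hM) cp).
have dDx : derivable ('D_w (x \o param c)) u v.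
  apply: diff_derivable; have [_ /(_ w)[+ _]] := position_smooth hM c 2.
  by apply; exists p.
have := @derive_val _ _ _ _ _ _ _ (is_derive_mink dN dDx).
rewrite (@near_eq_derive _ _ _ _ (cst 0)) ?derive_cst/= ?chartK//.
  by move=> /esym/eqP; rewrite addr_eq0 => /eqP.
apply: filterS (overlap_nbhs cp cp) => _ [q [cq _] <-] /=.
by rewrite chartK// (derive_mdiff hM)// (normal_orthogonal hM).
Qed.

Lemma shape_symmetric p v w :
  mink (mdiff N p v) (mdiff x p w) = mink (mdiff N p w) (mdiff x p v).
Proof.
apply: etrans (second_form_hessian p v w) _.
apply: etrans _ (esym (second_form_hessian p w v)).
apply: (congr1 (fun z => - mink (N p) z)).
apply: (@schwarz_mx _ _ _ _ (chart (chart_at p) @` (dom (chart_at p) `&` setT))).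
- exact/open_chart_image/openT.
- exact: position_smooth hM _ 2.
- by exists p => //; split=> //; exact: mem_chart_at.
Qed.

Local Notation t p := (tangential_part x p).
Local Notation T p := (mdiff x p (t p)).
Local Notation q p := (mink (x p) (x p)).
Local Notation r p := (mink (x p) (N p)).

(** [xget] falls back on 0 when no vector has the defining property, so a nonzero value certifies
    that property. *)
Lemma tangential_partP p w : t p != 0 ->
  mink (T p) (mdiff x p w) = mink (x p) (mdiff x p w).
Proof.
move=> t0; apply/esym/eqP; rewrite -subr_eq0 -minkBl; apply/eqP.
by move: t0; rewrite /tangential_part; case: xgetP => [v _ vP _|_ /eqP//]; exact: vP.
Qed.

(** Pairing [x] with [N] gives [b], and pairing it with [T] gives [a] as the length of [T].
    Arbitrary [a] and [b] cover both causal cases. *)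
Lemma position_decomposition p (a b : R) : t p != 0 ->
  x p = a *: e1 x p - b *: N p ->
  [/\ T p = x p + r p *: N p, 0 < q p + r p ^+ 2,
      a = Num.sqrt (q p + r p ^+ 2) & b = r p].
Proof.
move=> t0; rewrite /e1 /= -/(T p) /induced_metric => xE.
have TT : 0 < mink (T p) (T p) := induced_metric_gt0 hM p t0.
set s := Num.sqrt _ in xE; have s0 : 0 < s by rewrite sqrtr_gt0.
have ss : s * s = mink (T p) (T p) by rewrite -expr2 sqr_sqrtr// ltW.
have TN : mink (T p) (N p) = 0 by rewrite minkC (normal_orthogonal hM).
have rE : b = r p.
  by rewrite xE minkBl !minkZl TN (normal_unit hM); ring.
have aE : a = s.
  have : mink (T p) (T p) = a * s^-1 * mink (T p) (T p).
    rewrite {1}tangential_partP// {1}xE minkBl !minkZl.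
    by rewrite (normal_orthogonal hM) mulr0 subr0 mulrA.
  rewrite -{1}[mink _ _]mul1r => /(mulIf (lt0r_neq0 TT)) /esym.
  by move=> /(canRL (mulfVK (lt0r_neq0 s0))); rewrite mul1r.
have TE : T p = x p + r p *: N p.
  by rewrite {1}xE aE scalerA divff ?gt_eqF// scale1r rE subrK.
have TTE : mink (T p) (T p) = q p + r p ^+ 2.
  by rewrite tangential_partP// TE minkDr minkZr expr2.
by split=> //; rewrite -TTE.
Qed.

(** [sigma] stands for the sign of [<x, x>], so that [Num.sqrt (sigma * q p)] is [mu] in both causal
    cases. *)
Lemma mdiff_angle (theta : M -> R) (sigma : R) :
  (forall p, T p = x p + r p *: N p) ->
  (forall p, 0 < q p + r p ^+ 2) ->
  (forall p, 0 < sigma * q p) ->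
  (forall p, 0 < Num.sqrt (q p + r p ^+ 2) + r p) ->
  (forall p, theta p = ln (Num.sqrt (q p + r p ^+ 2) + r p) -
     ln (Num.sqrt (sigma * q p))) ->
  forall p v, induced_metric x p v (t p) = 0 ->
  mdiff theta p v =
    mink (mdiff N p (t p)) (mdiff x p v) / Num.sqrt (q p + r p ^+ 2).
Proof.
move=> TE qr0 sq0 A0 thetaE p v vT.
have sx := position_smooth hM; have sN := normal_smooth hM.
pose Q := (fun p' => q p') \o param (chart_at p).
pose P := (fun p' => r p') \o param (chart_at p).
set u := chart (chart_at p) p.
have Qu : Q u = q p by rewrite /Q /= chartK//; exact: mem_chart_at.
have Pu : P u = r p by rewrite /P /= chartK//; exact: mem_chart_at.
have xE : x p = T p - r p *: N p by rewrite TE addrK.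
(* Here [<dx v, x> = <dx v, T> = 0], since [x] and [T] differ by a normal vector. *)
have dQ : is_derive u v Q 0.
  apply: is_derive_eq (is_derive_mink_param p v sx sx) _.
  rewrite [X in _ + X]minkC -mulr2n [X in mink _ X]xE minkBr minkZr.
  rewrite [X in _ * X]minkC (normal_orthogonal hM).
  by rewrite mulr0 subr0 -/(induced_metric x p v (t p)) vT mul0rn.
set d := mink (mdiff N p (t p)) (mdiff x p v).
(* [<dx v, N>] vanishes, and [<x, dN v> = <T, dN v>] because [dN v] is orthogonal to [N]; symmetry
   of the second form then exchanges [T] and [dx v]. *)
have dP : is_derive u v P d.
  apply: is_derive_eq (is_derive_mink_param p v sx sN) _.
  rewrite [X in X + _]minkC (normal_orthogonal hM) add0r.
  rewrite xE minkBl minkZl.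
  by rewrite [X in _ * X]minkC mink_normal_mdiff mulr0 subr0 minkC shape_symmetric.
set s := Num.sqrt (q p + r p ^+ 2); have s0 : 0 < s by rewrite sqrtr_gt0.
have dqr : is_derive u v (Q + P * P) (2 * r p * d).
  apply: is_derive_eq (is_deriveD dQ (is_deriveM dP dP)) _.
  rewrite Pu add0r -[_ *: d]/(_ * d); set a := r p.
  by change (a * d + a * d = 2 * a * d); clearbody a d; ring.
have dsqrt : is_derive u v (Num.sqrt \o (Q + P * P)) ((2 * s)^-1 * (2 * r p * d)).
  apply: is_derive_comp1 => //; rewrite !fctE Qu Pu -expr2.
  exact: is_derive1_sqrt.
have dA : is_derive u v (@ln R \o ((Num.sqrt \o (Q + P * P)) + P))
    ((s + r p)^-1 * ((2 * s)^-1 * (2 * r p * d) + d)).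
  apply: is_derive_comp1 (is_deriveD dsqrt dP).
  have -> : (Num.sqrt \o (Q + P * P) + P) u = s + r p.
    by rewrite !fctE Qu Pu -expr2.
  exact/is_derive1_ln/A0.
have dB : is_derive u v (@ln R \o (Num.sqrt \o (sigma *: Q))) 0.
  have sQu : (sigma *: Q) u = sigma * q p by rewrite -Qu.
  have dsQ : is_derive u v (sigma *: Q) 0.
    by apply: is_derive_eq (is_deriveZ _ dQ) _; rewrite scaler0.
  have dsq : is_derive u v (Num.sqrt \o (sigma *: Q)) 0.
    rewrite -(mulr0 (2 * Num.sqrt (sigma * q p))^-1); apply: is_derive_comp1 dsQ.
    by rewrite sQu; exact/is_derive1_sqrt/sq0.
  rewrite -(mulr0 (Num.sqrt (sigma * q p))^-1); apply: is_derive_comp1 dsq.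
  by rewrite /= sQu; apply: is_derive1_ln; rewrite sqrtr_gt0; exact: sq0.
rewrite /mdiff (_ : theta \o _ = (@ln R \o ((Num.sqrt \o (Q + P * P)) + P)) -
   (@ln R \o (Num.sqrt \o (sigma *: Q)))); last first.
  by apply/funext => u' /=; rewrite thetaE !fctE -expr2.
rewrite (@derive_val _ _ _ _ _ _ _ (is_deriveB dA dB)) subr0.
have sr : s + r p != 0 by rewrite gt_eqF//; exact: A0.
have sn0 : s != 0 by rewrite gt_eqF.
(* With [a] for [r p], the identity is [(s + a)^-1 * (a * d / s + d) = d / s]. *)
move: (r p) sr => a sa; clearbody s d; field.
by rewrite sn0 sa.
Qed.

Lemma GCR_second_form : (forall p, t p != 0) ->
  GCR x N <-> forall p w, induced_metric x p w (t p) = 0 ->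
    mink (mdiff N p (t p)) (mdiff x p w) = 0.
Proof.
move=> t0; split=> [G p w wt|H p].
  have [_ [k /eqP]] := G p; rewrite /shape eqr_oppLR => /eqP ->.
  by rewrite minkNl minkZl minkC -/(induced_metric x p w (t p)) wt mulr0 oppr0.
split=> //.
have TT : mink (T p) (T p) != 0 by rewrite gt_eqF//; exact: (induced_metric_gt0 hM).
have DN := mink_normal_mdiff p (t p).
have TN : mink (T p) (N p) = 0 by rewrite minkC (normal_orthogonal hM).
(* [c *: T p] is the orthogonal projection of [dN T] on [T]; what remains is shown orthogonal to the
   tangent space and to [N]. *)
pose c := mink (mdiff N p (t p)) (T p) / mink (T p) (T p).
suff E : mdiff N p (t p) - c *: T p = 0.
  exists (- c); rewrite /shape scaleNr; congr (- _).
  by apply/eqP; rewrite -subr_eq0 E.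
have Hw w a : a * mink (T p) (T p) + mink (T p) (mdiff x p w) = 0 ->
    a * mink (mdiff N p (t p)) (T p) + mink (mdiff N p (t p)) (mdiff x p w) = 0.
  have dx := differentiable_position hM (mem_chart_at p).
  have aw : mdiff x p (a *: t p + w) = a *: T p + mdiff x p w by exact: mdiff_linear.
  have := H p (a *: t p + w); rewrite /induced_metric aw.
  move: (mdiff N p (t p)) (T p) (mdiff x p w) => D S W.
  by rewrite minkDl minkZl minkDr minkZr [mink W S]minkC => HH /HH.
apply: (normal_complement hM (p := p)) => [w|]; last first.
  move: (mdiff N p (t p)) (T p) c DN TN => D S c DN TN.
  by rewrite minkBl minkZl DN TN mulr0 subrr.
(* This coefficient makes [a *: t p + w] the component of [w] orthogonal to [T]. *)
have := Hw w (- (mink (T p) (mdiff x p w) / mink (T p) (T p))).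
rewrite /c; move: (mdiff N p (t p)) (T p) (mdiff x p w) TT => D S W S0.
rewrite mulNr divfK// addNr => /(_ erefl) E.
rewrite minkBl minkZl -[RHS]E.
move: (mink D S) (mink S W) (mink S S) (mink D W) S0 => d b s a s0.
by field.
Qed.

(** Writing [T] as [x + r N] and multiplying by [q + r^2] instead of dividing leaves a polynomial
    expression in the smooth maps [x] and [N]. The field is orthogonal to [T] when
    [<x, T> = q + r^2]. *)
Lemma msmooth_residual (a : 'rV[R]_n.+1) :
  msmooth (fun p => (q p + r p ^+ 2) *: a - mink a (x p + r p *: N p) *: x p).
Proof.
move=> i k; set U := chart i @` _.
have oU : open U by exact/open_chart_image/openT.
have Cx : Ck_on k U (x \o param i) := position_smooth hM i k.
have CN : Ck_on k U (N \o param i) := normal_smooth hM i k.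
have Cq : Ck_on k U (fun u => q (param i u)) by exact: Ck_mink.
have Cr : Ck_on k U (fun u => r (param i u)) by exact: Ck_mink.
have Ca : Ck_on k U (fun=> a) by exact: Ck_cst.
pose c u := q (param i u) + r (param i u) * r (param i u).
pose m u := mink a (x (param i u) + r (param i u) *: N (param i u)).
apply: (@Ck_eq _ _ _ _ oU _ (fun u => c u *: a + (-1 * m u) *: x (param i u))).
  by move=> u _ /=; rewrite mulN1r scaleNr.
apply: CkD => //; apply: Ck_scale => //.
  by apply: CkD => //; exact: CkM.
apply: CkM => //; first exact: Ck_cst.
apply: Ck_mink => //; apply: CkD => //; exact: Ck_scale.
Qed.

Lemma tangent_field_extension p w :
  (forall p, T p = x p + r p *: N p) ->
  (forall p, 0 < q p + r p ^+ 2) ->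
  induced_metric x p w (t p) = 0 ->
  exists Y : M -> 'rV[R]_n, [/\ smooth_vector_field Y,
    forall p', induced_metric x p' (Y p') (t p') = 0 &
    Y p = (q p + r p ^+ 2) *: w].
Proof.
move=> TE qr0 wt; set a := mdiff x p w.
have sZ := msmooth_residual a.
exists (fun p' => tproj x ((q p' + r p' ^+ 2) *: a -
  mink a (x p' + r p' *: N p') *: x p') p'); split.
- by apply: (smooth_tproj hM); exact: sZ.
- move=> p'; rewrite /induced_metric (tprojP hM) -TE minkBl !minkZl.
  have -> : mink (x p') (T p') = q p' + r p' ^+ 2 by rewrite TE minkDr minkZr expr2.
  by rewrite mulrC subrr.
(* At [p] itself [<a, T> = 0], so the ambient field is the tangent vector [(q + r^2) a]. *)
- apply/esym/(tproj_unique hM) => w'.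
  have dx := differentiable_position hM (mem_chart_at p).
  have aT : mink a (T p) = 0 by exact: wt.
  rewrite -TE aT scale0r subr0; congr (mink _ _).
  by rewrite [LHS](deriveE _ dx) linearZ/= -(deriveE _ dx).
Qed.

End AngleFunction.

(** The two causal cases only exchange [cosh] and [sinh] in the coefficients of [x], so this sum is
    common to both. *)
Lemma expR_cosh_sinh (R : realType) (a : R) : expR a = cosh a + sinh a.
Proof. by rewrite /cosh /sinh; field. Qed.

Theorem proposition9 (R : realType) (n : nat) (M : smooth_manifold R n)
    (x N : M -> 'rV[R]_n.+1) (theta : M -> R)
    (hM : spacelike_hypersurface x N)
    (hxT : forall p : M, tangential_part x p != 0)
    (htheta :
      ((forall p : M, 0 < mink (x p) (x p)) /\
       (forall p : M, x p = (mu x p * cosh (theta p)) *: e1 x p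
                            - (mu x p * sinh (theta p)) *: N p))
      \/
      ((forall p : M, mink (x p) (x p) < 0) /\
       (forall p : M, 0 < mink (x p) (N p)) /\
       (forall p : M, x p = (mu x p * sinh (theta p)) *: e1 x p
                            - (mu x p * cosh (theta p)) *: N p))) :
  GCR x N <->
  (forall Y : M -> 'rV[R]_n, smooth_vector_field Y ->
     (forall p : M, induced_metric x p (Y p) (tangential_part x p) = 0) ->
     forall p : M, mdiff theta p (Y p) = 0).
Proof.
have [sigma [sq0 absE TE qr0 expE]] : exists sigma : R,
    [/\ forall p, 0 < sigma * mink (x p) (x p),
     forall p, `|mink (x p) (x p)| = sigma * mink (x p) (x p),
     forall p, mdiff x p (tangential_part x p) = x p + mink (x p) (N p) *: N p,
     forall p, 0 < mink (x p) (x p) + mink (x p) (N p) ^+ 2 &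
     forall p, mu x p * expR (theta p) =
       Num.sqrt (mink (x p) (x p) + mink (x p) (N p) ^+ 2) + mink (x p) (N p)].
  case: htheta => [[q0 xE]|[q0 [_ xE]]].
    exists 1; split=> p; have [TE qr0 aE bE] := position_decomposition hM (hxT p) (xE p) => //.
    - by rewrite mul1r.
    - by rewrite mul1r gtr0_norm.
    - by rewrite expR_cosh_sinh mulrDr aE bE.
  exists (-1); split=> p; have [TE qr0 aE bE] := position_decomposition hM (hxT p) (xE p) => //.
  - by rewrite mulN1r oppr_gt0.
  - by rewrite mulN1r ltr0_norm.
  - by rewrite expR_cosh_sinh mulrDr aE bE addrC.
have mu0 p : 0 < mu x p by rewrite /mu absE sqrtr_gt0.
have angleE := mdiff_angle hM TE qr0 sq0.
have {}angleE p v : induced_metric x p v (tangential_part x p) = 0 ->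
    mdiff theta p v = mink (mdiff N p (tangential_part x p)) (mdiff x p v) /
      Num.sqrt (mink (x p) (x p) + mink (x p) (N p) ^+ 2).
  (* The argument of the logarithm is [mu * expR theta], hence positive, and its logarithm is
     [ln mu + theta]. *)
  apply: angleE => {p v} p; first by rewrite -expE mulr_gt0// expR_gt0.
  by rewrite -expE -absE -/(mu x p) lnM ?posrE ?expR_gt0// expRK addrC addKr.
apply: iff_trans (GCR_second_form hM hxT) _; split=> [H Y _ YT p|H p w wt].
  by rewrite (angleE p _ (YT p)) (H p _ (YT p)) mul0r.
have [Y [sY YT YE]] := tangent_field_extension hM TE qr0 wt.
have := H Y sY YT p; rewrite (angleE p _ (YT p)).
have -> : mdiff x p (Y p) =
    (mink (x p) (x p) + mink (x p) (N p) ^+ 2) *: mdiff x p w.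
  have dx := differentiable_position hM (mem_chart_at p).
  by rewrite YE [LHS](deriveE _ dx) linearZ/= -(deriveE _ dx).
move: (mink (x p) (x p) + _) (qr0 p) => c c0.
rewrite minkZr => /eqP; rewrite !mulf_eq0 invr_eq0 sqrtr_eq0 leNgt c0 orbF.
by rewrite (gt_eqF c0) => /eqP.
Qed.
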